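(* Let $P$ be a monoid and let $\Lambda$ be a $P$-graph. Then the following are equivalent: (i) $\Lambda$ is aperiodic; (ii) $\operatorname{Per}\Lambda=\{0\}$; (iii) $\Lambda$ has no local periodicity.
   Context: All monoids are finitely generated, cancellative and abelian; $P$ is embedded in its Grothendieck group $\mathcal{G}(P)$ and is also regarded as a category with one object. A $P$-graph is a countable small category $\Lambda$ (identified with its set of morphisms) with a functor $d:\Lambda\to P$ satisfying the factorization property: whenever $d(\xi)=p+q$ there are unique $\eta,\zeta\in\Lambda$ with $d(\eta)=p$, $d(\zeta)=q$, $\xi=\eta\zeta$. $\Lambda^p=d^{-1}(p)$, $\Lambda^0$ is the vertex set, $r,s:\Lambda\to\Lambda^0$ are the range and source maps. All $P$-graphs are assumed row-finite and source-free: $0<|\{\xi\in\Lambda^p:r(\xi)=v\}|<\infty$ for all $v\in\Lambda^0$, $p\in P$. $\Omega_P=\{(p,q)\in P\times P: q-p\in P\}$ is the $P$-graph with $d(p,q)=q-p$, $s(p,q)=q$, $r(p,q)=p$. An infinite path of $\Lambda$ is a degree-preserving functor $x:\Omega_P\to\Lambda$; $\Lambda^\infty$ is the set of these, and $v\Lambda^\infty$ the set of those with range $x(0,0)=v$. For $p\in P$, $\sigma^p(x)(q,r)=x(p+q,p+r)$. For $\mu\in\Lambda$ and $x\in s(\mu)\Lambda^\infty$, $\mu x$ is the unique infinite path with $(\mu x)(0,p)=\mu\cdot x(0,p-d(\mu))$ for all $p\in P$ with $p-d(\mu)\in P$. An infinite path $x$ is periodic if $\sigma^p(x)=\sigma^q(x)$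 for some $p\ne q$ in $P$. $\Lambda$ is periodic if there is $v\in\Lambda^0$ such that every $x\in v\Lambda^\infty$ is periodic; otherwise $\Lambda$ is aperiodic. The equivalence relation $\sim$ on $\Lambda$: $\xi\sim\eta$ iff $s(\xi)=s(\eta)$ and $\xi x=\eta x$ for all $x\in s(\xi)\Lambda^\infty$. $\operatorname{Per}\Lambda=\{d(\xi)-d(\eta):\xi,\eta\in\Lambda,\ \xi\sim\eta\}\subseteq\mathcal{G}(P)$. For $v\in\Lambda^0$, $\Sigma_v=\{(m,n)\in P\times P:\sigma^m(x)=\sigma^n(x)\text{ for all }x\in v\Lambda^\infty\}$ and $\operatorname{Per}_v=\{m-n:(m,n)\in\Sigma_v\}$. $\Lambda$ has no local periodicity if $\operatorname{Per}_v=\{0\}$ for all $v\in\Lambda^0$. *)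

(* Defs.v *)
From HB Require Import structures.
From mathcomp Require Import all_boot ssralg.
From mathcomp Require Import boolp classical_sets functions cardinality.

Set Implicit Arguments.
Unset Strict Implicit.
Unset Printing Implicit Defensive.

Import GRing.Theory.
#[local] Obligation Tactic := idtac.
Local Open Scope classical_set_scope.
Local Open Scope ring_scope.
Local Open Scope quotient_scope.

HB.mixin Record isFgCancellative P & GRing.Nmodule P := {
  addmI : forall p q r : P, p + q = p + r -> q = r;
  fg_monoid : exists (n : nat) (g : 'I_n -> P),
    forall p : P, exists c : 'I_n -> nat, p = \sum_i g i *+ c i
}.

#[short(type="fgMonoidType")]
HB.structure Definition FgMonoid := {P of isFgCancellative P & GRing.Nmodule P}.

Lemma addIm (P : fgMonoidType) (p q r : P) : q + p = r + p -> q = r.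
Proof. by rewrite ![_ + p]addrC => /addmI. Qed.

Lemma fg_countable (P : fgMonoidType) : countable [set: P].
Proof.
have [n [g gP]] := @fg_monoid P.
pose c p : {ffun 'I_n -> nat} := [ffun i => projT1 (cid (gP p)) i].
apply/countable_injP; exists (pickle \o c) => p q _ _ /= /(pcan_inj pickleK) cpq.
rewrite (projT2 (cid (gP p))) (projT2 (cid (gP q))).
apply: eq_bigr => i _; congr (_ *+ _).
by have := congr1 (fun f : {ffun 'I_n -> nat} => f i) cpq; rewrite !ffunE.
Qed.

Section GrothendieckGroup.
Variable P : fgMonoidType.
Implicit Types x y z : P * P.

(* The pair (a, b) stands for the formal difference a - b. *)
Definition groth_eq x y := x.1 + y.2 == y.1 + x.2.

Lemma groth_eq_refl : reflexive groth_eq.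
Proof. by move=> x; rewrite /groth_eq. Qed.

Lemma groth_eq_sym : symmetric groth_eq.
Proof. by move=> x y; rewrite /groth_eq eq_sym. Qed.

Lemma groth_eq_trans : transitive groth_eq.
Proof.
move=> y x z /eqP xy /eqP yz; apply/eqP; apply: (@addIm _ y.2).
by rewrite addrAC xy addrAC yz addrAC.
Qed.

Canonical groth_equiv :=
  EquivRel groth_eq groth_eq_refl groth_eq_sym groth_eq_trans.

Definition groth := {eq_quot groth_eq}.

HB.instance Definition _ : EqQuotient _ groth_eq groth := EqQuotient.on groth.
HB.instance Definition _ := Choice.on groth.

Definition groth_pair_opp x := (x.2, x.1).
Definition groth_pair_add x y := (x.1 + y.1, x.2 + y.2).

Definition groth_zero : groth := \pi_groth (0, 0).
Definition groth_opp := lift_op1 groth groth_pair_opp.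
Definition groth_add := lift_op2 groth groth_pair_add.

Lemma pi_groth_opp : {morph \pi : x / groth_pair_opp x >-> groth_opp x}.
Proof.
move=> x; unlock groth_opp; apply/eqmodP => /=.
have /eqmodP/eqP /= e : \pi_groth x = \pi_groth (repr (\pi_groth x)).
  by rewrite reprK.
by rewrite /groth_eq /= addrC -e addrC.
Qed.
Canonical pi_groth_opp_morph := PiMorph1 pi_groth_opp.

Lemma pi_groth_add : {morph \pi : x y / groth_pair_add x y >-> groth_add x y}.
Proof.
move=> x y; unlock groth_add; apply/eqmodP => /=.
have /eqmodP/eqP /= ex : \pi_groth x = \pi_groth (repr (\pi_groth x)).
  by rewrite reprK.
have /eqmodP/eqP /= ey : \pi_groth y = \pi_groth (repr (\pi_groth y)).
  by rewrite reprK.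
by rewrite /groth_eq /= addrACA ex ey addrACA.
Qed.
Canonical pi_groth_add_morph := PiMorph2 pi_groth_add.

Lemma groth_addA : associative groth_add.
Proof.
elim/quotW=> x; elim/quotW=> y; elim/quotW=> z; rewrite !piE.
by rewrite /groth_pair_add /= !addrA.
Qed.

Lemma groth_addC : commutative groth_add.
Proof.
elim/quotW=> x; elim/quotW=> y; rewrite !piE.
by rewrite /groth_pair_add addrC [x.2 + _]addrC.
Qed.

Lemma groth_add0 : left_id groth_zero groth_add.
Proof.
elim/quotW=> x; rewrite /groth_zero !piE /groth_pair_add /= !add0r.
by rewrite -surjective_pairing.
Qed.

Lemma groth_addN : left_inverse groth_zero groth_opp groth_add.
Proof.
elim/quotW=> x; rewrite /groth_zero !piE; apply/eqmodP.
by rewrite /= /groth_eq /= addr0 add0r addrC.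
Qed.

HB.instance Definition _ :=
  GRing.isZmodule.Build groth groth_addA groth_addC groth_add0 groth_addN.

Definition to_groth (p : P) : groth := \pi_groth (p, 0).

Lemma to_groth0 : to_groth 0 = 0. Proof. by []. Qed.

Lemma to_grothD p q : to_groth (p + q) = to_groth p + to_groth q.
Proof.
rewrite /to_groth [RHS](_ : _ = groth_add (\pi_groth (p, 0)) (\pi_groth (q, 0))) //.
by rewrite !piE /groth_pair_add /= addr0.
Qed.

Lemma to_groth_inj : injective to_groth.
Proof. by move=> p q /eqmodP /=; rewrite /groth_eq /= !addr0 => /eqP. Qed.

Lemma to_groth_surj (g : groth) : exists p q, g = to_groth p - to_groth q.
Proof.
elim/quotW: g => x; exists x.1, x.2.
rewrite /to_groth [RHS](_ : _ =
  groth_add (\pi_groth (x.1, 0)) (groth_opp (\pi_groth (x.2, 0)))) //.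
by rewrite !piE /groth_pair_add /= addr0 add0r -surjective_pairing.
Qed.

Lemma to_grothB p q k :
  to_groth q - to_groth p = to_groth k <-> q = p + k.
Proof.
split=> [/eqP|->]; last by rewrite to_grothD addrAC subrr add0r.
by rewrite subr_eq -to_grothD addrC => /eqP /to_groth_inj.
Qed.

End GrothendieckGroup.

Arguments to_groth {P} p.

(* [comp f g] is the composite fg of f after g; its value carries no meaning
   unless [src f = rng g], and every axiom is restricted to that case. *)
Record category := Category {
  obj : Type;
  mor : Type;
  rng : mor -> obj;
  src : mor -> obj;
  idm : obj -> mor;
  comp : mor -> mor -> mor;
  rng_id : forall v, rng (idm v) = v;
  src_id : forall v, src (idm v) = v;
  rng_comp : forall f g, src f = rng g -> rng (comp f g) = rng f;
  src_comp : forall f g, src f = rng g -> src (comp f g) = src g;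
  comp_idl : forall f, comp (idm (rng f)) f = f;
  comp_idr : forall f, comp f (idm (src f)) = f;
  comp_assoc : forall f g h, src f = rng g -> src g = rng h ->
    comp f (comp g h) = comp (comp f g) h
}.

Arguments rng {c}. Arguments src {c}. Arguments idm {c}. Arguments comp {c}.

Record functor (C D : category) := Functor {
  fobj : obj C -> obj D;
  fmor :> mor C -> mor D;
  functor_rng : forall f, rng (fmor f) = fobj (rng f);
  functor_src : forall f, src (fmor f) = fobj (src f);
  functor_id : forall v, fmor (idm v) = idm (fobj v);
  functor_comp : forall f g, src f = rng g ->
    fmor (comp f g) = comp (fmor f) (fmor g)
}.

Lemma functor_eq (C D : category) (F G : functor C D) :
  fobj F = fobj G -> fmor F = fmor G -> F = G.
Proof.
case: F G => [Fo Fm F1 F2 F3 F4] [Go Gm G1 G2 G3 G4] /= eo em.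
by subst Go Gm; congr Functor; exact: Prop_irrelevance.
Qed.

Program Definition compose (C D E : category) (G : functor D E)
    (F : functor C D) : functor C E :=
  @Functor C E (fobj G \o fobj F) (G \o F) _ _ _ _.
Next Obligation. by move=> C D E G F f /=; rewrite !functor_rng. Qed.
Next Obligation. by move=> C D E G F f /=; rewrite !functor_src. Qed.
Next Obligation. by move=> C D E G F v /=; rewrite !functor_id. Qed.
Next Obligation.
move=> C D E G F f g fg /=; rewrite !functor_comp //.
by rewrite functor_src functor_rng fg.
Qed.

Program Definition monoid_cat (P : fgMonoidType) : category :=
  @Category unit P (fun=> tt) (fun=> tt) (fun=> 0) (fun p q => p + q)
    _ _ _ _ _ _ _.
Next Obligation. by move=> P []. Qed.
Next Obligation. by move=> P []. Qed.
Next Obligation. by []. Qed.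
Next Obligation. by []. Qed.
Next Obligation. by move=> P p /=; rewrite add0r. Qed.
Next Obligation. by move=> P p /=; rewrite addr0. Qed.
Next Obligation. by move=> P p q r _ _ /=; rewrite addrA. Qed.

Record pgraph (P : fgMonoidType) := PGraph {
  pg_cat :> category;
  pg_deg : functor pg_cat (monoid_cat P);
  pg_countable : countable [set: mor pg_cat];
  pg_factor : forall (xi : mor pg_cat) (p q : P), pg_deg xi = p + q ->
    exists! ez : mor pg_cat * mor pg_cat,
      [/\ pg_deg ez.1 = p, pg_deg ez.2 = q,
          src ez.1 = rng ez.2 & xi = comp ez.1 ez.2]
}.

Definition deg (P : fgMonoidType) (L : pgraph P) (xi : mor L) : P :=
  pg_deg L xi.

(* The vertices are the objects of L; through [idm] they are exactly the
   morphisms of degree 0, by [deg_id] and [deg0_id]. *)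
Notation vertex L := (obj L) (only parsing).

Section PGraphTheory.
Variables (P : fgMonoidType) (L : pgraph P).
Implicit Types (v : vertex L) (xi eta zeta : mor L) (p q : P).

Lemma deg_id v : deg (idm v) = 0.
Proof. exact: (functor_id (pg_deg L) v). Qed.

Lemma deg_comp xi eta : src xi = rng eta -> deg (comp xi eta) = deg xi + deg eta.
Proof. exact: (@functor_comp _ _ (pg_deg L)). Qed.

Lemma factor_uniq xi eta xi' eta' : deg xi = deg xi' -> deg eta = deg eta' ->
  src xi = rng eta -> src xi' = rng eta' ->
  comp xi eta = comp xi' eta' -> xi = xi' /\ eta = eta'.
Proof.
move=> dxi deta cxe cxe' e.
have [ez [_ ez_uniq]] := pg_factor (deg_comp cxe).
have e1 := ez_uniq (xi, eta) (And4 erefl erefl cxe erefl).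
have e2 : ez = (xi', eta').
  by apply: ez_uniq; split=> //=; rewrite -?dxi -?deta.
by move: e2; rewrite e1 => -[].
Qed.

Lemma factor_ex xi p q : deg xi = p + q -> exists eta zeta,
  [/\ deg eta = p, deg zeta = q, src eta = rng zeta & xi = comp eta zeta].
Proof. by move=> /pg_factor [[eta zeta] [h _]]; exists eta, zeta. Qed.

Lemma comp_inj xi eta eta' : src xi = rng eta -> src xi = rng eta' ->
  comp xi eta = comp xi eta' -> eta = eta'.
Proof.
move=> c c' e; have := congr1 (@deg P L) e.
by rewrite !deg_comp // => /addmI de; have [] := factor_uniq erefl de c c' e.
Qed.

Lemma deg0_id xi : deg xi = 0 -> xi = idm (rng xi).
Proof.
move=> d0; suff [] : xi = idm (rng xi) /\ idm (src xi) = xi by [].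
by apply: factor_uniq; rewrite ?deg_id ?rng_id ?src_id ?comp_idl ?comp_idr.
Qed.

Definition row_finite :=
  forall v p, finite_set [set xi : mor L | rng xi = v /\ deg xi = p].

Definition source_free :=
  forall v p, [set xi : mor L | rng xi = v /\ deg xi = p] !=set0.

End PGraphTheory.

Arguments row_finite {P} L.
Arguments source_free {P} L.

Section Omega.
Variable P : fgMonoidType.
Implicit Types p q r k : P.

Definition diff_in p q := exists k, to_groth q - to_groth p = to_groth k.

Lemma diff_inP p q : diff_in p q <-> exists k, q = p + k.
Proof. by split=> -[k /to_grothB ?]; exists k => //; apply/to_grothB. Qed.

Lemma diff_in_refl p : diff_in p p.
Proof. by apply/diff_inP; exists 0; rewrite addr0. Qed.

Lemma diff_in_trans p q r : diff_in p q -> diff_in q r -> diff_in p r.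
Proof.
move=> /diff_inP [k ->] /diff_inP [l ->]; apply/diff_inP.
by exists (k + l); rewrite addrA.
Qed.

Lemma diff_in0 p : diff_in 0 p.
Proof. by apply/diff_inP; exists p; rewrite add0r. Qed.

Lemma diff_inD p k : diff_in p (p + k).
Proof. by apply/diff_inP; exists k. Qed.

Lemma diff_inDl r p q : diff_in p q -> diff_in (r + p) (r + q).
Proof.
by move=> /diff_inP [k ->]; apply/diff_inP; exists k; rewrite addrA.
Qed.

(* The pair (p, q). *)
Record omega_mor := OmegaMor {
  om_rng : P;
  om_src : P;
  om_diff : diff_in om_rng om_src
}.

Lemma omega_mor_eq (a b : omega_mor) :
  om_rng a = om_rng b -> om_src a = om_src b -> a = b.
Proof.
case: a b => [p q h] [p' q' h'] /= ep eq; subst p' q'.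
by congr OmegaMor; exact: Prop_irrelevance.
Qed.

(* (p, q)(q, r) = (p, r); the left factor is returned on pairs that are not
   composable. *)
Definition omega_comp (a b : omega_mor) : omega_mor :=
  match pselect (om_src a = om_rng b) with
  | left e => OmegaMor (diff_in_trans (om_diff a)
                (eq_ind_r (fun p => diff_in p (om_src b)) (om_diff b) e))
  | right _ => a
  end.

Lemma omega_compE a b : om_src a = om_rng b ->
  om_rng (omega_comp a b) = om_rng a /\ om_src (omega_comp a b) = om_src b.
Proof. by rewrite /omega_comp; case: pselect. Qed.

Program Definition omega_cat : category :=
  @Category P omega_mor om_rng om_src (fun p => OmegaMor (diff_in_refl p))
    omega_comp _ _ _ _ _ _ _.
Next Obligation. by []. Qed.
Next Obligation. by []. Qed.
Next Obligation. by move=> a b /omega_compE []. Qed.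
Next Obligation. by move=> a b /omega_compE []. Qed.
Next Obligation.
move=> a; have [] := @omega_compE (OmegaMor (diff_in_refl (om_rng a))) a erefl.
by move=> r s; apply: omega_mor_eq.
Qed.
Next Obligation.
move=> a; have [] := @omega_compE a (OmegaMor (diff_in_refl (om_src a))) erefl.
by move=> r s; apply: omega_mor_eq.
Qed.
Next Obligation.
move=> a b c ab bc.
have [r1 s1] := omega_compE ab; have [r2 s2] := omega_compE bc.
have [r3 s3] := @omega_compE a (omega_comp b c) (etrans ab (esym r2)).
have [r4 s4] := @omega_compE (omega_comp a b) c (etrans s1 bc).
by apply: omega_mor_eq; rewrite ?r3 ?r4 ?s3 ?s4.
Qed.

Definition omega_deg (a : omega_mor) : P := projT1 (cid (om_diff a)).

Lemma omega_degE a :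
  to_groth (omega_deg a) = to_groth (om_src a) - to_groth (om_rng a).
Proof. by rewrite (projT2 (cid (om_diff a))). Qed.

Lemma omega_degP a k : omega_deg a = k <-> om_src a = om_rng a + k.
Proof.
rewrite -to_grothB -omega_degE.
by split=> [->|/to_groth_inj].
Qed.

Program Definition omega_deg_functor : functor omega_cat (monoid_cat P) :=
  @Functor omega_cat (monoid_cat P) (fun=> tt) omega_deg _ _ _ _.
Next Obligation. by []. Qed.
Next Obligation. by []. Qed.
Next Obligation. by move=> p; apply/omega_degP => /=; rewrite addr0. Qed.
Next Obligation.
move=> a b /= ab; have [ra sb] := omega_compE ab; apply/omega_degP.
have /omega_degP ea := erefl (omega_deg a).
have /omega_degP eb := erefl (omega_deg b).
by rewrite ra sb eb -ab ea addrA.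
Qed.

Lemma omega_countable : countable [set: mor omega_cat].
Proof.
have /countable_injP [f f_inj] := fg_countable P.
apply/countable_injP; exists (fun a => pickle (f (om_rng a), f (om_src a))).
move=> a b _ _ /(pcan_inj pickleK) [er es].
by apply: omega_mor_eq; apply: f_inj; rewrite ?inE.
Qed.

Lemma omega_factor (a : mor omega_cat) p q : omega_deg_functor a = p + q ->
  exists! ez : mor omega_cat * mor omega_cat,
    [/\ omega_deg_functor ez.1 = p, omega_deg_functor ez.2 = q,
        src ez.1 = rng ez.2 & a = comp ez.1 ez.2].
Proof.
move=> /= /omega_degP da.
have h : diff_in (om_rng a + p) (om_src a) by rewrite da addrA; exact: diff_inD.
exists (OmegaMor (diff_inD (om_rng a) p), OmegaMor h); split.
  split=> //=; [exact/omega_degP|by apply/omega_degP; rewrite /= da addrA|].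
  have [] := @omega_compE (OmegaMor (diff_inD (om_rng a) p)) (OmegaMor h) erefl.
  by move=> /= r s; apply: omega_mor_eq.
move=> [b c] /= [/omega_degP db /omega_degP dc bc abc].
have [r s] := omega_compE bc; rewrite -abc in r s.
by congr pair; apply: omega_mor_eq => /=; rewrite -?bc ?db ?r ?s.
Qed.

Definition omega : pgraph P := PGraph omega_countable omega_factor.

Definition shift_omega_mor (r : P) (a : omega_mor) : omega_mor :=
  OmegaMor (diff_inDl r (om_diff a)).

(* (q, r) |-> (p + q, p + r) *)
Program Definition translate (p : P) : functor omega omega :=
  @Functor omega omega (fun q => p + q) (shift_omega_mor p) _ _ _ _.
Next Obligation. by []. Qed.
Next Obligation. by []. Qed.
Next Obligation. by move=> p q; apply: omega_mor_eq. Qed.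
Next Obligation.
move=> p a b /= ab; have [r s] := omega_compE ab.
have ab' : om_src (shift_omega_mor p a) = om_rng (shift_omega_mor p b).
  by rewrite /= ab.
have [r' s'] := omega_compE ab'.
by apply: omega_mor_eq; rewrite ?r' ?s' /= ?r ?s.
Qed.

Lemma deg_translate p a : deg (translate p a) = deg (a : mor omega).
Proof.
apply/omega_degP => /=; have /omega_degP -> := erefl (omega_deg a).
by rewrite addrA.
Qed.

(* The pair (0, p). *)
Definition from0 (p : P) : mor omega := OmegaMor (diff_in0 p).

End Omega.

Section InfinitePaths.
Variables (P : fgMonoidType) (L : pgraph P).

Record infpath := InfPath {
  ip_functor :> functor (omega P) L;
  ip_deg : forall a : mor (omega P), deg (ip_functor a) = deg a
}.

Implicit Types (x y : infpath) (v : vertex L) (mu xi eta : mor L) (p q : P).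

(* The vertex x(0,0). *)
Definition path_rng x : vertex L := fobj x 0.

Lemma path_rngE x : x (from0 0) = idm (path_rng x).
Proof. by rewrite /path_rng -functor_id; congr (fmor x _); exact: omega_mor_eq. Qed.

Definition vpaths v : set infpath := [set x | path_rng x = v].

Program Definition shift p x : infpath := @InfPath (compose x (translate p)) _.
Next Obligation. by move=> p x a /=; rewrite ip_deg deg_translate. Qed.

Lemma deg_from0 p : deg (from0 p) = p.
Proof. by apply/omega_degP; rewrite /= add0r. Qed.

Lemma rng_from0 x p : rng (x (from0 p)) = path_rng x.
Proof. by rewrite functor_rng. Qed.

Lemma path_split x (a : omega_mor P) : src (x (from0 (om_rng a))) = rng (x a) /\
  x (from0 (om_src a)) = comp (x (from0 (om_rng a))) (x a).
Proof.
split; first by rewrite functor_src functor_rng.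
rewrite -functor_comp //; congr (fmor x _).
have [r s] := @omega_compE P (from0 (om_rng a)) a erefl.
by apply: omega_mor_eq; rewrite /= ?r ?s.
Qed.

Lemma infpath_eq x y : (forall p, x (from0 p) = y (from0 p)) -> x = y.
Proof.
move=> exy; have em : fmor x = fmor y.
  apply: funext => a.
  have [cx ex] := path_split x a; have [cy ey] := path_split y a.
  apply: (comp_inj cx); first by rewrite exy.
  by rewrite -ex !exy.
have eo : fobj x = fobj y.
  apply: funext => p; rewrite -[p](_ : rng (idm p : mor (omega P)) = p) //.
  by rewrite -!functor_rng em.
move: (functor_eq eo em) => {exy em eo}.
case: x y => [x hx] [y hy] /= exy; subst y.
by congr InfPath; exact: Prop_irrelevance.
Qed.

Lemma infpath_of_segments (a : P -> mor L) :
  (forall p, deg (a p) = p) ->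
  (forall p q, exists b, src (a p) = rng b /\ a (p + q) = comp (a p) b) ->
  exists x, forall p, x (from0 p) = a p.
Proof.
move=> da ha.
have hb (e : omega_mor P) : exists b,
    src (a (om_rng e)) = rng b /\ a (om_src e) = comp (a (om_rng e)) b.
  by case: e => p q /= /diff_inP [k ->]; exact: ha.
pose m e := projT1 (cid (hb e)).
have mc e : src (a (om_rng e)) = rng (m e) by case: (projT2 (cid (hb e))).
have me e : a (om_src e) = comp (a (om_rng e)) (m e).
  by case: (projT2 (cid (hb e))).
have mu e b : src (a (om_rng e)) = rng b ->
    a (om_src e) = comp (a (om_rng e)) b -> m e = b.
  move=> cb eb; apply: (comp_inj (mc e) cb); by rewrite -me.
have ms e : src (m e) = src (a (om_src e)) by rewrite me src_comp.
have mid (v : obj (omega P)) : m (idm v) = idm (src (a v)).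
  by apply: mu => /=; rewrite ?rng_id ?comp_idr.
have mcomp (e f : mor (omega P)) : src e = rng f ->
    m (comp e f) = comp (m e) (m f).
  move=> /= ef; have [r s] := omega_compE ef.
  have c : src (m e) = rng (m f) by rewrite ms ef mc.
  apply: mu; rewrite r ?s; first by rewrite rng_comp // mc.
  by rewrite comp_assoc ?mc // -me ef -me.
pose F := @Functor (omega P) L (fun p => src (a p)) m
  (fun e => esym (mc e)) ms mid mcomp.
have dF e : deg (F e) = deg e.
  apply/esym/omega_degP; have := congr1 (@deg P L) (me e).
  by rewrite deg_comp ?mc // !da.
exists (InfPath dF) => p.
have a0 : a 0 = idm (rng (a 0)) by apply: deg0_id; rewrite da.
have m0 := mc (from0 p); have m1 := me (from0 p).
rewrite /= in m0 m1 *; rewrite m1 a0 -[in RHS](_ : rng (m (from0 p)) = rng (a 0)).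
  by rewrite comp_idl.
by rewrite -m0 a0 src_id rng_id.
Qed.

(* y = mu x.  Here q is the element p - d(mu) of P. *)
Definition is_concat mu x y := forall p q,
  to_groth p - to_groth (deg mu) = to_groth q ->
  y (from0 p) = comp mu (x (from0 q)).

Lemma is_concatP mu x y : is_concat mu x y <->
  forall q, y (from0 (deg mu + q)) = comp mu (x (from0 q)).
Proof. by split=> h => [q|p q /to_grothB ->]; apply: h; apply/to_grothB. Qed.

Lemma concat_ex_uniq mu x : src mu = path_rng x -> exists! y, is_concat mu x y.
Proof.
move=> mux.
have cq q : src mu = rng (x (from0 q)) by rewrite rng_from0.
have hs p : exists az : mor L * mor L, [/\ deg az.1 = p, deg az.2 = deg mu,
    src az.1 = rng az.2 & comp mu (x (from0 p)) = comp az.1 az.2].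
  have dp : deg (comp mu (x (from0 p))) = p + deg mu.
    by rewrite deg_comp // ip_deg deg_from0 addrC.
  by have [a [z h]] := factor_ex dp; exists (a, z).
pose a p := (projT1 (cid (hs p))).1; pose z p := (projT1 (cid (hs p))).2.
have hP p : [/\ deg (a p) = p, deg (z p) = deg mu, src (a p) = rng (z p)
    & comp mu (x (from0 p)) = comp (a p) (z p)] := projT2 (cid (hs p)).
have a_uniq p b c : deg b = p -> src b = rng c ->
    comp mu (x (from0 p)) = comp b c -> a p = b.
  move=> db bc e; have [d1 d2 ac ea] := hP p.
  have := congr1 (@deg P L) (etrans (esym ea) e).
  rewrite !deg_comp // d1 db => /addmI dz.
  by have [] := factor_uniq (etrans d1 (esym db)) dz ac bc (etrans (esym ea) e).
have xs p q : src (x (from0 p)) = rng (x (OmegaMor (diff_inD p q))) /\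
    x (from0 (p + q)) = comp (x (from0 p)) (x (OmegaMor (diff_inD p q))).
  exact: (path_split x (OmegaMor (diff_inD p q))).
have [||y yP] := @infpath_of_segments a; first by move=> p; case: (hP p).
  move=> p q; have [d1 d2 c1 e1] := hP p; have [c2 e2] := xs p q.
  set t := x (OmegaMor _) in c2 e2.
  have c3 : src (z p) = rng t.
    by rewrite -c2 -[LHS](src_comp c1) -e1 src_comp.
  have dt : deg t = q.
    have := congr1 (@deg P L) e2; rewrite deg_comp // !ip_deg !deg_from0.
    by move/addmI.
  have [b [w [db dw bw e3]]] : exists b w, [/\ deg b = q, deg w = deg mu,
      src b = rng w & comp (z p) t = comp b w].
    by apply: factor_ex; rewrite deg_comp // dt d2 addrC.
  have c4 : src (a p) = rng b.
    by rewrite c1 -(rng_comp c3) e3 rng_comp.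
  exists b; split=> //; apply: (@a_uniq _ _ w).
  - by rewrite deg_comp // d1 db.
  - by rewrite src_comp.
  - by rewrite e2 comp_assoc // e1 -!comp_assoc // e3.
exists y; split.
  apply/is_concatP => q; rewrite yP.
  have [c e] := xs q (deg mu); set t := x (OmegaMor _) in c e.
  apply: (a_uniq _ _ t).
  - by rewrite deg_comp // ip_deg deg_from0.
  - by rewrite src_comp.
  - by rewrite [deg mu + q]addrC e comp_assoc.
move=> y' /is_concatP hy'; apply: infpath_eq => p; rewrite yP.
have := path_split y' (OmegaMor (diff_inD p (deg mu))) => -[/= c e].
apply: (a_uniq p _ _ _ c); first by rewrite ip_deg deg_from0.
by rewrite -e [p + _]addrC hy'.
Qed.

Definition concat mu x (h : src mu = path_rng x) : infpath :=
  projT1 (cid (concat_ex_uniq h)).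

Lemma concatP mu x (h : src mu = path_rng x) : is_concat mu x (concat h).
Proof. by case: (projT2 (cid (concat_ex_uniq h))). Qed.

Definition periodic_path x := exists p q, p <> q /\ shift p x = shift q x.

Definition periodic := exists v, forall x, vpaths v x -> periodic_path x.

Definition aperiodic := ~ periodic.

Definition path_equiv xi eta := src xi = src eta /\
  forall x (hxi : src xi = path_rng x) (heta : src eta = path_rng x),
    concat hxi = concat heta.

Definition Per : set (groth P) :=
  [set g | exists xi eta, path_equiv xi eta /\
             g = to_groth (deg xi) - to_groth (deg eta)].

Definition Sigma_at v : set (P * P) :=
  [set mn | forall x, vpaths v x -> shift mn.1 x = shift mn.2 x].

Definition Per_at v : set (groth P) :=
  [set g | exists m n, Sigma_at v (m, n) /\ g = to_groth m - to_groth n].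

Definition no_local_periodicity := forall v, Per_at v = [set 0].

End InfinitePaths.

Arguments periodic {P} L.
Arguments aperiodic {P} L.
Arguments Per {P} L.
Arguments no_local_periodicity {P} L.

(* Main.v *)
Require Import Defs.
From mathcomp Require Import all_boot ssralg.
From mathcomp Require Import classical_sets.
From mathcomp Require Import boolp cardinality.

(** Everything reduces to local periodicity at a vertex.
    - If [xi ~ eta], then shifting [xi x = eta x] by [d(xi) + d(eta)] gives
      [(d(eta), d(xi)) \in Sigma_(s(xi))].
    - If [(m, n) \in Sigma_v], factor any [mu] of range [v] and degree [m + n]
      as [mu = alpha gamma = beta delta] with [d(alpha) = m], [d(beta) = n];
      then [gamma x = sigma^m(mu x) = sigma^n(mu x) = delta x] for all [x], so
      [gamma ~ delta].
    - If there is no local periodicity, a Baire category argument yields an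
      aperiodic path with range [v]: treating the countably many pairs [p <> q]
      one after the other, a finite path [mu] extends to some [mu nu] such that
      [sigma^p(x) <> sigma^q(x)] for every [x] beginning with [mu nu]. *)

Set Implicit Arguments.
Unset Strict Implicit.
Unset Printing Implicit Defensive.

Import GRing.Theory.
Local Open Scope classical_set_scope.
Local Open Scope ring_scope.

(* [ssrfun.comp] would otherwise shadow composition in a category. *)
Local Notation comp := Defs.comp.

(** * Enumeration of countable index types *)

Lemma countable_enum (T : Type) (t0 : T) : countable [set: T] ->
  exists e : nat -> T, forall t, exists n, e n = t.
Proof.
move=> /countable_injP [f f_inj].
(* Indices outside the range of [f] go to the default value [t0]. *)
exists (fun n => if pselect (exists t, f t = n) is left h then projT1 (cid h)
                 else t0) => t.
exists (f t); case: pselect => [h|[]]; last by exists t.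
by apply: f_inj; rewrite ?inE //; exact: (projT2 (cid h)).
Qed.

Lemma countable_prod (T U : Type) :
  countable [set: T] -> countable [set: U] -> countable [set: T * U].
Proof.
move=> /countable_injP [f f_inj] /countable_injP [g g_inj].
apply/countable_injP; exists (fun z => pickle (f z.1, g z.2)).
move=> [t u] [t' u'] _ _ /(pcan_inj pickleK) /= [ft gu].
by congr pair; [apply: f_inj|apply: g_inj]; rewrite ?inE.
Qed.

(** * Chains of finite paths and their limits *)

Section FinitePaths.
Variables (P : fgMonoidType) (L : pgraph P).
Implicit Types (v : vertex L) (a b c mu nu : mor L) (p : P).

Definition prefix_of a b := exists c, src a = rng c /\ b = comp a c.

Lemma prefix_of_refl a : prefix_of a a.
Proof. by exists (idm (src a)); rewrite rng_id comp_idr. Qed.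

Lemma prefix_of_trans a b c : prefix_of a b -> prefix_of b c -> prefix_of a c.
Proof.
move=> [e [ae ->]] [f [ef ->]]; rewrite src_comp // in ef.
by exists (comp e f); rewrite rng_comp // comp_assoc.
Qed.

Lemma prefix_of_uniq a b c :
  prefix_of a c -> prefix_of b c -> deg a = deg b -> a = b.
Proof.
move=> [e [ae ->]] [f [bf ef]] dab.
have := congr1 (@deg P L) ef; rewrite !deg_comp // dab => /addmI de.
by have [] := factor_uniq dab de ae bf ef.
Qed.

Lemma prefix_of_ex b p k : deg b = p + k -> exists a, deg a = p /\ prefix_of a b.
Proof. by move=> /factor_ex [a [c [da _ ac ->]]]; exists a; split=> //; exists c. Qed.

Lemma chain_le (mu : nat -> mor L) :
  (forall n, prefix_of (mu n) (mu n.+1)) ->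
  forall m n, (m <= n)%N -> prefix_of (mu m) (mu n).
Proof.
move=> h m n /subnK <-; elim: (n - m)%N => [|k IH]; first exact: prefix_of_refl.
exact: prefix_of_trans IH (h _).
Qed.

(** Cofinality of the degrees gives some [mu n] a prefix of degree [p]. Two such prefixes lie below
    a common member of the chain, so they agree by unique factorization and the segments cohere. *)
Lemma infpath_of_chain (mu : nat -> mor L) :
  (forall n, prefix_of (mu n) (mu n.+1)) ->
  (forall p, exists n k, deg (mu n) = p + k) ->
  exists x : infpath L, forall n, x (from0 (deg (mu n))) = mu n.
Proof.
move=> /chain_le mono cof.
have seg p : exists a, deg a = p /\ exists n, prefix_of a (mu n).
  by have [n [k /prefix_of_ex [a [da an]]]] := cof p; exists a; split=> //; exists n.
pose a p := projT1 (cid (seg p)).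
have da p : deg (a p) = p by case: (projT2 (cid (seg p))).
have an p : exists n, prefix_of (a p) (mu n) by case: (projT2 (cid (seg p))).
have a_uniq p b n : deg b = p -> prefix_of b (mu n) -> a p = b.
  move=> db bn; have [m am] := an p.
  apply: (@prefix_of_uniq _ _ (mu (maxn m n))); last by rewrite da db.
    exact: prefix_of_trans am (mono _ _ (leq_maxl _ _)).
  exact: prefix_of_trans bn (mono _ _ (leq_maxr _ _)).
have [p q|x xP] := infpath_of_segments da.
  have [b [db ba]] := prefix_of_ex (da (p + q)); have [n apq] := an (p + q).
  by rewrite (a_uniq p b n db (prefix_of_trans ba apq)); exact: ba.
exists x => n; rewrite xP; exact: a_uniq erefl (prefix_of_refl _).
Qed.

(** The Baire argument: the requirements are enumerated, and step [n.+1] extends the current path so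
    as to meet the [n]-th one. *)
Lemma generic_chain (T : Type) (D : T -> mor L -> Prop) v :
  inhabited T -> countable [set: T] ->
  (forall t mu, exists nu, src mu = rng nu /\ D t (comp mu nu)) ->
  exists mu : nat -> mor L, [/\ forall n, rng (mu n) = v,
    forall n, prefix_of (mu n) (mu n.+1) & forall t, exists n, D t (mu n)].
Proof.
move=> [t0] /(countable_enum t0) [e eP] dense.
pose ext t mu := projT1 (cid (dense t mu)).
have extP t mu : src mu = rng (ext t mu) /\ D t (comp mu (ext t mu)).
  exact: projT2 (cid (dense t mu)).
pose fix mu n := if n is k.+1 then comp (mu k) (ext (e k) (mu k)) else idm v.
exists mu; split=> [|n|t]; last 1 first.
- by have [n <-] := eP t; exists n.+1; have [] := extP (e n) (mu n).
- elim=> [|n IH] /=; first by rewrite rng_id.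
  by rewrite rng_comp //; case: (extP (e n) (mu n)).
- by exists (ext (e n) (mu n)); split=> //; case: (extP (e n) (mu n)).
Qed.

End FinitePaths.

(** * Shifts and truncations of infinite paths *)

Section Shifts.
Variables (P : fgMonoidType) (L : pgraph P).
Implicit Types (x y : infpath L) (v : vertex L) (mu nu xi eta : mor L).
Implicit Types (p q k : P).

Lemma shift_shift p q x : shift p (shift q x) = shift (q + p) x.
Proof.
by apply: infpath_eq => r; congr (fmor x _); apply: omega_mor_eq; rewrite /= addrA.
Qed.

Lemma shiftC p q x : shift p (shift q x) = shift q (shift p x).
Proof. by rewrite !shift_shift addrC. Qed.

Lemma shift_split x p q : src (x (from0 p)) = rng (shift p x (from0 q)) /\
  x (from0 (p + q)) = comp (x (from0 p)) (shift p x (from0 q)).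
Proof.
have [/= c e] := path_split x (translate p (from0 q)).
by rewrite addr0 in c e.
Qed.

Lemma is_concat_uniq mu x y y' : src mu = path_rng x ->
  is_concat mu x y -> is_concat mu x y' -> y = y'.
Proof.
by move=> /concat_ex_uniq [z [_ zu]] /zu zy /zu; rewrite -zy.
Qed.

Lemma is_concat_head mu x y : src mu = path_rng x ->
  is_concat mu x y -> y (from0 (deg mu)) = mu.
Proof.
move=> c /is_concatP/(_ 0).
by rewrite addr0 path_rngE -c comp_idr.
Qed.

(** The segment of [y] of degree [deg mu + deg nu + q] splits after degree [deg mu] in two ways, by
    restricting [y] and by associativity; uniqueness identifies the tails. *)
Lemma is_concat_shift_comp mu nu x y : src mu = rng nu -> src nu = path_rng x ->
  is_concat (comp mu nu) x y -> is_concat nu x (shift (deg mu) y).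
Proof.
move=> mn nx /is_concatP h; apply/is_concatP => q.
have cx : src nu = rng (x (from0 q)) by rewrite rng_from0.
have [c e] := shift_split y (deg mu) (deg nu + q).
have := h q; rewrite deg_comp // -addrA e -comp_assoc // => e'.
have [] := factor_uniq _ _ c _ e'; rewrite ?rng_comp //.
  by rewrite ip_deg deg_from0.
by rewrite deg_comp // !ip_deg !deg_from0.
Qed.

Lemma is_concat_tail mu x y : src mu = path_rng x ->
  is_concat mu x y -> shift (deg mu) y = x.
Proof.
move=> c h; apply: infpath_eq => q.
have [c1 e] := shift_split y (deg mu) q.
rewrite (is_concat_head c h) in c1 e.
apply: (comp_inj c1); first by rewrite rng_from0.
by rewrite -e; move/is_concatP: h => ->.
Qed.

Lemma head_prefix x y p k :
  x (from0 (p + k)) = y (from0 (p + k)) ->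
  x (from0 p) = y (from0 p) /\ shift p x (from0 k) = shift p y (from0 k).
Proof.
have [cx ->] := shift_split x p k; have [cy ->] := shift_split y p k.
by apply: factor_uniq; rewrite ?ip_deg ?deg_from0.
Qed.

(** * Triviality of the periodicity sets in terms of degrees *)

Lemma Per_at0 v : Per_at v 0.
Proof. by exists 0, 0; rewrite subrr. Qed.

Lemma Per_atP v : Per_at v = [set 0] <->
  (forall m n, Sigma_at v (m, n) -> m = n).
Proof.
split=> [e m n mn|h]; last first.
  apply/seteqP; split=> [g [m [n [/h -> ->]]]|g ->]; first by rewrite subrr.
  exact: Per_at0.
have : Per_at v (to_groth m - to_groth n) by exists m, n.
by rewrite e => /= /eqP; rewrite subr_eq0 => /eqP/to_groth_inj.
Qed.

(** A vertex is essential here: in the empty graph [Per L] is empty. *)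
Lemma Per0 : inhabited (vertex L) -> Per L 0.
Proof.
move=> [v]; exists (idm v), (idm v); rewrite subrr; split=> //; split=> // x h h'.
exact: is_concat_uniq h (concatP h) (concatP h').
Qed.

Lemma PerP : inhabited (vertex L) -> (Per L = [set 0] <->
  (forall xi eta, path_equiv xi eta -> deg xi = deg eta)).
Proof.
move=> L0; split=> [e xi eta xe|h]; last first.
  apply/seteqP; split=> [g [xi [eta [/h -> ->]]]|g ->]; first by rewrite subrr.
  exact: Per0.
have : Per L (to_groth (deg xi) - to_groth (deg eta)) by exists xi, eta.
by rewrite e => /= /eqP; rewrite subr_eq0 => /eqP/to_groth_inj.
Qed.

(** * Passage between equivalent paths and local periodicity *)

Lemma path_equiv_Sigma xi eta : path_equiv xi eta ->
  Sigma_at (src xi) (deg eta, deg xi).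
Proof.
move=> [s e] x /= /esym hx; have hx' : src eta = path_rng x by rewrite -s.
rewrite -[in LHS](is_concat_tail hx (concatP hx)) (e x hx hx').
by rewrite shiftC (is_concat_tail hx' (concatP hx')).
Qed.

Lemma Sigma_path_equiv v p q : source_free L -> Sigma_at v (p, q) ->
  exists xi eta, [/\ path_equiv xi eta, deg xi = q & deg eta = p].
Proof.
move=> /(_ v (p + q)) [mu [rmu dmu]] S.
have [al [ga [dal dga ag mu1]]] := factor_ex dmu.
have [be [de [dbe dde bd mu2]]] : exists be de, [/\ deg be = q, deg de = p,
    src be = rng de & mu = comp be de] by apply: factor_ex; rewrite dmu addrC.
have sga : src mu = src ga by rewrite mu1 src_comp.
have sde : src mu = src de by rewrite mu2 src_comp.
exists ga, de; split=> //; split; first by rewrite -sga -sde.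
move=> x hg hd; have hm : src mu = path_rng x by rewrite sga.
have hy := concatP hm; set y := concat hm in hy.
have vy : vpaths v y.
  (* The path [y] begins with [mu], so its range is that of [mu]. *)
  by rewrite /vpaths /= -rmu -(rng_from0 y (deg mu)) (is_concat_head hm hy).
apply: (is_concat_uniq hg (concatP hg)).
have -> : concat hd = shift p y.
  rewrite (S _ vy) /= -dbe; apply: (is_concat_uniq hd (concatP hd)).
  by apply: is_concat_shift_comp; rewrite -?mu2.
by rewrite -dal; apply: is_concat_shift_comp; rewrite -?mu1.
Qed.

(** * Construction of an aperiodic path *)

(** The degree clause is imposed on the pairs [(p, p)] as well; these make the degrees along the
    generic chain cofinal, so that it has a limit. *)
Definition separates (pq : P * P) mu := (exists k, deg mu = pq.1 + k) /\
  (pq.1 <> pq.2 -> forall x, x (from0 (deg mu)) = mu -> shift pq.1 x <> shift pq.2 x).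

(** Some [y] from [src mu] has distinct shifts by [p] and [q], and the difference shows on a finite
    segment. Taking [nu] to be a long enough initial segment of [y] forces it on every path through
    [comp mu nu]. *)
Lemma separating_extension : source_free L -> no_local_periodicity L ->
  forall pq mu, exists nu, src mu = rng nu /\ separates pq (comp mu nu).
Proof.
move=> sf nlp [p q] mu; case: (pselect (p = q)) => [<-|npq].
  have [nu [rnu dnu]] := sf (src mu) p; exists nu; split=> //; split=> //=.
  by exists (deg mu); rewrite deg_comp // dnu addrC.
have [y [vy yS]] : exists y, vpaths (src mu) y /\ shift p y <> shift q y.
  apply: contrapT => h; apply: npq; move/Per_atP: (nlp (src mu)); apply=> y vy /=.
  by apply: contrapT => hy; apply: h; exists y.
have [r yr] : exists r, shift p y (from0 r) <> shift q y (from0 r).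
  apply: contrapT => h; apply: yS; apply: infpath_eq => r.
  by apply: contrapT => hr; apply: h; exists r.
(* [N] exceeds both [p + r] and [q + r], so [nu] determines the segments of degree [r] of both
   shifts of [y]. *)
pose N := p + q + r; pose nu := y (from0 N).
have dnu : deg nu = N by rewrite ip_deg deg_from0.
have mn : src mu = rng nu by rewrite rng_from0.
exists nu; split=> //; split=> [|_ x] /=; rewrite deg_comp // dnu.
  by exists (deg mu + (q + r)); rewrite /N -addrA [RHS]addrCA.
have [c ->] := shift_split x (deg mu) N => e e'; apply: yr.
set z := shift (deg mu) x in c e.
(* Shifts commute, so equality of the two shifts of [x] passes to its tail [z], which begins with
   [nu]. *)
have zp : shift p z = shift q z by rewrite /z shiftC e' shiftC.
have zy : z (from0 N) = y (from0 N).
  by have [] := factor_uniq _ _ c mn e; rewrite ?dnu ?ip_deg ?deg_from0.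
have zyp : shift p z (from0 r) = shift p y (from0 r).
  suff /head_prefix[] : z (from0 (p + r)) = y (from0 (p + r)) by [].
  suff /head_prefix[] : z (from0 (p + r + q)) = y (from0 (p + r + q)) by [].
  by rewrite addrAC.
have zyq : shift q z (from0 r) = shift q y (from0 r).
  suff /head_prefix[] : z (from0 (q + r)) = y (from0 (q + r)) by [].
  suff /head_prefix[] : z (from0 (q + r + p)) = y (from0 (q + r + p)) by [].
  by rewrite addrC addrA.
by rewrite -zyp zp.
Qed.

Lemma aperiodic_path_ex v : source_free L -> no_local_periodicity L ->
  exists x, vpaths v x /\ ~ periodic_path x.
Proof.
move=> sf nlp.
have cP := countable_prod (fg_countable P) (fg_countable P).
have [mu [rmu pmu smu]] := generic_chain v (inhabits ((0, 0) : P * P)) cP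
  (separating_extension sf nlp).
have [p|x xmu] := infpath_of_chain pmu.
  by have [n [hk _]] := smu (p, p); exists n.
exists x; split; first by rewrite /vpaths /= -(rmu 0%N) -xmu rng_from0.
move=> [p [q [npq]]]; have [n [_ h]] := smu (p, q).
exact: h npq _ (xmu n).
Qed.

(** * The equivalences *)

Lemma aperiodicP : source_free L -> aperiodic L <-> no_local_periodicity L.
Proof.
move=> sf; split=> [ap v|nlp [v per]].
  apply/Per_atP => m n mn; apply: contrapT => nmn; apply: ap.
  by exists v => x vx; exists m, n; split=> //; exact: (mn x vx).
by have [x [/per]] := aperiodic_path_ex v sf nlp.
Qed.

Lemma Per_no_local_periodicity : inhabited (vertex L) -> source_free L ->
  Per L = [set 0] <-> no_local_periodicity L.
Proof.
move=> L0 sf; split=> [/(PerP L0) h v|nlp].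
  apply/Per_atP => m n /(Sigma_path_equiv sf) [xi [eta [/h e <- <-]]].
  by rewrite e.
apply/(PerP L0) => xi eta /path_equiv_Sigma S.
by have /Per_atP/(_ _ _ S) := nlp (src xi).
Qed.

End Shifts.

Theorem theorem4p6 (P : fgMonoidType) (L : pgraph P)
    (L_nonempty : inhabited (vertex L))
    (L_row_finite : row_finite L) (L_source_free : source_free L) :
  (aperiodic L <-> Per L = [set 0%R]%classic) /\
  (Per L = [set 0%R]%classic <-> no_local_periodicity L).
Proof.
have PL := Per_no_local_periodicity L_nonempty L_source_free.
by split=> //; apply: iff_trans (aperiodicP L_source_free) (iff_sym PL).
Qed.
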